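(* Let $(s_1,s_2,p)\in\mathbb C^3$. Then the following are equivalent: (1) $(s_1,s_2,p)\in\Gamma_3$; (2) $(\omega s_1,\omega^2 s_2,\omega^3 p)\in\Gamma_3$ for all $\omega\in\mathbb T$; (3) $|p|\le 1$ and there exists $(c_1,c_2)\in\Gamma_2$ such that $$s_1=c_1+\bar{c_2}\,p\quad\text{and}\quad s_2=c_2+\bar{c_1}\,p.$$
   Context: Here $\overline{\mathbb D}$ is the closed unit disc and $\mathbb T$ the unit circle in $\mathbb C$. The closed symmetrized bidisc and tridisc are $$\Gamma_2=\{(z_1+z_2,\ z_1z_2): z_1,z_2\in\overline{\mathbb D}\}\subseteq\mathbb C^2,$$ $$\Gamma_3=\{(z_1+z_2+z_3,\ z_1z_2+z_2z_3+z_3z_1,\ z_1z_2z_3): z_1,z_2,z_3\in\overline{\mathbb D}\}\subseteq\mathbb C^3.$$ *)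

(* Defs.v *)
From HB Require Import structures.
From mathcomp Require Import all_boot all_order all_algebra.
From mathcomp Require Import complex.
From mathcomp Require Import boolp classical_sets reals.

Set Implicit Arguments.
Unset Strict Implicit.
Unset Printing Implicit Defensive.

Import Order.TTheory GRing.Theory Num.Theory.

Local Open Scope ring_scope.
Local Open Scope complex_scope.
Local Open Scope classical_set_scope.

(* The norm on [R[i]] takes its (real) values in [R[i]] itself, so that
   [`|z| <= 1] is the usual inequality between real numbers. *)
Definition closed_disc (R : realType) : set R[i] := [set z | `|z| <= 1].

Definition unit_circle (R : realType) : set R[i] := [set z | `|z| = 1].

Definition Gamma2 (R : realType) : set (R[i] * R[i]) :=
  [set w | exists z1 z2 : R[i],
    [/\ closed_disc z1, closed_disc z2 & w = (z1 + z2, z1 * z2)]].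

Definition Gamma3 (R : realType) : set (R[i] * R[i] * R[i]) :=
  [set w | exists z1 z2 z3 : R[i],
    [/\ closed_disc z1, closed_disc z2, closed_disc z3 &
        w = (z1 + z2 + z3, z1 * z2 + z2 * z3 + z3 * z1, z1 * z2 * z3)]].

(* Main.v *)
Require Import Defs.
From HB Require Import structures.
From mathcomp Require Import all_boot all_order all_algebra.
From mathcomp Require Import complex.
From mathcomp Require Import boolp classical_sets reals.
From mathcomp Require Import ring.

Set Implicit Arguments.
Unset Strict Implicit.
Unset Printing Implicit Defensive.

Import Order.TTheory GRing.Theory Num.Theory.

Local Open Scope ring_scope.
Local Open Scope complex_scope.
Local Open Scope classical_set_scope.

(** Identify [(s1, s2, p)] with the cubic P(z) = z^3 - s1 z^2 + s2 z - p and
    [(c1, c2)] with the quadratic q(z) = z^2 - c1 z + c2; membership in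
    [Gamma3] or [Gamma2] says that all roots lie in the closed disc
    ([Gamma3_of_roots], [Gamma2_of_roots]).  For a polynomial f of degree n
    write f^# (z) = z^n conj (f (1 / conj z)) for its reflection in the circle.
    The equations s1 = c1 + conj(c2) p and s2 = c2 + conj(c1) p say exactly that
    P = z q - p q^#.  Everything rests on the Blaschke estimate
    |f^# (z)| <= |f z| for |z| >= 1, valid when the roots of a monic f lie in
    the closed disc; it is checked factor by factor
    ([norm_reflected_factor_le]).

    From c to s ([Gamma3_of_Gamma2]): if q has its roots in the disc, then for
    |z| > 1 we get |z q z| > |q z| >= |p q^# (z)|, so P z <> 0.

    From s to c with |p| < 1 ([Gamma2_of_Gamma3_lt1]): the two equations
    together with their conjugates form an invertible linear system, whose
    solution satisfies (1 - |p|^2) z q = P + p P^#.  For |z| > 1 the estimate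
    for P gives |P z| > |p P^# (z)|, so q z <> 0.

    From s to c with |p| = 1 ([Gamma2_of_Gamma3_eq1]): the linear system is
    singular, but the roots of P are then unimodular, and dropping one of them
    leaves a suitable q.

    Finally, the action of omega on the triple multiplies each root of P by
    omega, and omega = 1 recovers the original triple. *)

Section SymmetrizedDiscs.

(* Under a [ring_scope] operator, [^*] already denotes [Num.conj]; reopening
   the scope makes it do so everywhere, so that the two syntactically distinct
   conjugations of [R[i]] do not mix. *)
Local Open Scope ring_scope.

Variable R : realType.
Implicit Types (a b c s p u v w z : R[i]).

(** The difference of the two squares is (|z|^2 - 1) (1 - |a|^2). *)
Lemma norm_reflected_factor_le a z :
  `|a| <= 1 -> 1 <= `|z| -> `|1 - a^* * z| <= `|z - a|.
Proof.
move=> a_le1 z_ge1; rewrite -ler_sqr ?nnegrE // -subr_ge0.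
have -> : `|z - a| ^+ 2 - `|1 - a^* * z| ^+ 2
          = (`|z| ^+ 2 - 1) * (1 - `|a| ^+ 2).
  rewrite !normCK !rmorphB !rmorphM rmorph1 /= conjCK; ring.
by rewrite mulr_ge0 ?subr_ge0 ?exprn_ege1 ?exprn_ile1.
Qed.

Lemma sub_neq0_of_norm_lt u v : `|v| < `|u| -> u - v != 0.
Proof. by apply: contraTneq => /subr0_eq ->; rewrite ltxx. Qed.

Lemma sub_closed_disc_neq0 a z : `|a| <= 1 -> 1 < `|z| -> z - a != 0.
Proof. by move=> a_le1 z_gt1; apply/sub_neq0_of_norm_lt/(le_lt_trans a_le1). Qed.

Lemma closed_disc_of_root (f : R[i] -> R[i]) z :
  (forall w, 1 < `|w| -> f w != 0) -> f z = 0 -> closed_disc z.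
Proof.
move=> f_neq0 fz0; rewrite /closed_disc /=.
case: (real_leP (normr_real z) (real1 _)) => // /f_neq0.
by rewrite fz0 eqxx.
Qed.

Lemma quadratic_splits s p : exists z1 z2, s = z1 + z2 /\ p = z1 * z2.
Proof.
have [z] := @solve_monicpoly R[i] 2 (nth 0 [:: - p; s]) isT.
rewrite !big_ord_recr big_ord0 /= => z_root.
exists z, (s - z); split; first by ring.
have -> : z * (s - z) = s * z - z ^+ 2 by ring.
by rewrite z_root; ring.
Qed.

Lemma cubic_splits s1 s2 p : exists z1 z2 z3,
  [/\ s1 = z1 + z2 + z3, s2 = z1 * z2 + z2 * z3 + z3 * z1 & p = z1 * z2 * z3].
Proof.
have [z] := @solve_monicpoly R[i] 3 (nth 0 [:: p; - s2; s1]) isT.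
rewrite !big_ord_recr big_ord0 /= => z_root.
(* The quotient of the cubic by its factor at z is
   X^2 - (s1 - z) X + (s2 - z (s1 - z)). *)
have [z2 [z3 [sumE prodE]]] := quadratic_splits (s1 - z) (s2 - z * (s1 - z)).
exists z, z2, z3; split.
- by rewrite -addrA -sumE; ring.
- have -> : z * z2 + z2 * z3 + z3 * z = z * (z2 + z3) + z2 * z3 by ring.
  by rewrite -sumE -prodE; ring.
- rewrite -mulrA -prodE.
  have -> : z * (s2 - z * (s1 - z)) = z ^+ 3 - s1 * z ^+ 2 + s2 * z by ring.
  by rewrite z_root; ring.
Qed.

Lemma Gamma2_of_roots s p :
  (forall z, 1 < `|z| -> z ^+ 2 - s * z + p != 0) -> Gamma2 (s, p).
Proof.
have [z1 [z2 [-> ->]]] := quadratic_splits s p => root_bound.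
by exists z1, z2; split=> //; apply: (closed_disc_of_root root_bound); ring.
Qed.

Lemma Gamma3_of_roots s1 s2 p :
  (forall z, 1 < `|z| -> z ^+ 3 - s1 * z ^+ 2 + s2 * z - p != 0) ->
  Gamma3 (s1, s2, p).
Proof.
have [z1 [z2 [z3 [-> -> ->]]]] := cubic_splits s1 s2 p => root_bound.
by exists z1, z2, z3; split=> //; apply: (closed_disc_of_root root_bound); ring.
Qed.

(** The cubic of the resulting triple is z q - p qr, where q is the quadratic of
    (c1, c2) and qr its reflection in the circle; the first term dominates
    outside the closed disc. *)
Lemma Gamma3_of_Gamma2 c1 c2 p :
  `|p| <= 1 -> Gamma2 (c1, c2) -> Gamma3 (c1 + c2^* * p, c2 + c1^* * p, p).
Proof.
move=> p_le1 [a [b [a_le1 b_le1 [-> ->]]]].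
apply: Gamma3_of_roots => z z_gt1.
set q := (z - a) * (z - b); set qr := (1 - a^* * z) * (1 - b^* * z).
have -> : z ^+ 3 - (a + b + (a * b)^* * p) * z ^+ 2
          + (a * b + (a + b)^* * p) * z - p = z * q - p * qr.
  by rewrite rmorphD rmorphM /= /q /qr; ring.
have q_neq0 : q != 0 by rewrite mulf_neq0 ?sub_closed_disc_neq0.
apply: sub_neq0_of_norm_lt; rewrite !normrM.
apply: (@le_lt_trans _ _ `|q|); last by rewrite -normrM ltr_pMl ?normr_gt0.
rewrite -[leRHS]mul1r ler_pM ?mulr_ge0 // normrM.
by rewrite ler_pM // norm_reflected_factor_le // ltW.
Qed.

Lemma Gamma2_of_Gamma3_lt1 s1 s2 p :
  `|p| < 1 -> Gamma3 (s1, s2, p) -> exists c1 c2,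
    [/\ Gamma2 (c1, c2), s1 = c1 + c2^* * p & s2 = c2 + c1^* * p].
Proof.
move=> p_lt1 [a [b [c [a_le1 b_le1 c_le1 [s1E s2E pE]]]]].
have N_neq0 : 1 - p * p^* != 0.
  by rewrite -normCK subr_eq0 eq_sym lt_eqF // exprn_ilt1.
have N_real : (1 - p * p^*)^* = 1 - p * p^*.
  by rewrite rmorphB rmorphM rmorph1 /= conjCK mulrC.
(* Eliminating conj(c2) from s1 = c1 + conj(c2) p by means of the conjugate of
   the second equation gives c1; c2 is obtained symmetrically. *)
exists ((s1 - s2^* * p) / (1 - p * p^*)), ((s2 - s1^* * p) / (1 - p * p^*)).
split; last 2 first.
- rewrite fmorph_div /= N_real rmorphB rmorphM /= conjCK.
  by field.
- rewrite fmorph_div /= N_real rmorphB rmorphM /= conjCK.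
  by field.
apply: Gamma2_of_roots => z z_gt1.
set P := (z - a) * (z - b) * (z - c).
set Pr := (1 - a^* * z) * (1 - b^* * z) * (1 - c^* * z).
(* P + p Pr is (1 - |p|^2) z times the quadratic of (c1, c2): the constant
   terms - p and p cancel. *)
suff : P - - (p * Pr) != 0.
  apply: contra_neq => q_eq0; rewrite opprK.
  transitivity ((1 - p * p^*) * z * (z ^+ 2
    - (s1 - s2^* * p) / (1 - p * p^*) * z + (s2 - s1^* * p) / (1 - p * p^*)));
    last by rewrite q_eq0 mulr0.
  transitivity ((1 - p * p^*) * z ^+ 3 - (s1 - s2^* * p) * z ^+ 2
                + (s2 - s1^* * p) * z); last by field.
  by rewrite /P /Pr s1E s2E pE !(rmorphD, rmorphM) /=; ring.
have P_neq0 : P != 0 by rewrite !mulf_neq0 ?sub_closed_disc_neq0.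
apply: sub_neq0_of_norm_lt; rewrite normrN normrM.
apply: (@le_lt_trans _ _ (`|p| * `|P|)); last by rewrite gtr_pMl ?normr_gt0.
rewrite ler_wpM2l // !normrM.
by rewrite !ler_pM ?mulr_ge0 // norm_reflected_factor_le // ltW.
Qed.

Lemma norm_eq1_of_mul a b :
  `|a| <= 1 -> `|b| <= 1 -> `|a * b| = 1 -> `|a| = 1.
Proof.
move=> a_le1 b_le1 ab_eq1; apply/le_anti; rewrite a_le1 -ab_eq1 normrM.
by rewrite ler_piMr.
Qed.

(** With unimodular roots a, b, c, the pair (a + b, a b) works because
    conj(a b) p = c. *)
Lemma Gamma2_of_Gamma3_eq1 s1 s2 p :
  `|p| = 1 -> Gamma3 (s1, s2, p) -> exists c1 c2,
    [/\ Gamma2 (c1, c2), s1 = c1 + c2^* * p & s2 = c2 + c1^* * p].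
Proof.
move=> p_eq1 [a [b [c [a_le1 b_le1 c_le1 [-> -> pE]]]]].
rewrite pE in p_eq1 *.
have aa : a * a^* = 1.
  rewrite -normCK (@norm_eq1_of_mul a (b * c)) ?expr1n ?mulrA //.
  by rewrite normrM mulr_ile1.
have bb : b * b^* = 1.
  rewrite -normCK (@norm_eq1_of_mul b (a * c)) ?expr1n //.
    by rewrite normrM mulr_ile1.
  by rewrite mulrCA mulrA.
exists (a + b), (a * b); split; first by exists a, b.
- have -> : (a * b)^* * (a * b * c) = (a * a^*) * (b * b^*) * c.
    by rewrite rmorphM /=; ring.
  by rewrite aa bb !mul1r.
- have -> : (a + b)^* * (a * b * c) = (a * a^*) * b * c + (b * b^*) * a * c.
    by rewrite rmorphD /=; ring.
  by rewrite aa bb; ring.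
Qed.

Lemma Gamma3_norm_le1 s1 s2 p : Gamma3 (s1, s2, p) -> `|p| <= 1.
Proof.
move=> [a [b [c [a_le1 b_le1 c_le1 [_ _ ->]]]]].
by rewrite !normrM !mulr_ile1 ?mulr_ge0.
Qed.

Lemma Gamma3_rotate w s1 s2 p : unit_circle w -> Gamma3 (s1, s2, p) ->
  Gamma3 (w * s1, w ^+ 2 * s2, w ^+ 3 * p).
Proof.
rewrite /unit_circle /= => w_eq1 [a [b [c [a_le1 b_le1 c_le1 [-> -> ->]]]]].
exists (w * a), (w * b), (w * c).
split; rewrite /closed_disc /= ?normrM ?w_eq1 ?mul1r //.
by congr (_, _, _); ring.
Qed.

End SymmetrizedDiscs.

Theorem theorem2p1 (R : realType) (s1 s2 p : R[i]) :
  [<-> Gamma3 (s1, s2, p);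
       forall omega : R[i], unit_circle omega ->
         Gamma3 (omega * s1, omega ^+ 2 * s2, omega ^+ 3 * p);
       `|p| <= 1 /\
         exists c1 c2 : R[i],
           [/\ Gamma2 (c1, c2), s1 = c1 + c2^* * p & s2 = c2 + c1^* * p]].
Proof.
tfae.
- by move=> G3 omega omega_eq1; apply: Gamma3_rotate.
- move=> /(_ 1 (normr1 _)); rewrite !expr1n !mul1r => G3.
  have p_le1 := Gamma3_norm_le1 G3; split=> //.
  have [p_eq1|p_neq1] := eqVneq `|p| 1; first exact: Gamma2_of_Gamma3_eq1.
  by apply: Gamma2_of_Gamma3_lt1; rewrite // lt_neqAle p_neq1.
- by move=> [p_le1 [c1 [c2 [G2 -> ->]]]]; apply: Gamma3_of_Gamma2.
Qed.
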